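(* The group $\mathrm{SL}_3(2)$ is power-chordal, and the group $\mathrm{SL}_3(4)$ is not power-chordal.
   Context: The power graph of a group $G$ is the simple graph with vertex set $G$ in which two distinct elements $x,y$ are joined by an edge if and only if $x^m=y$ or $y^m=x$ for some $m\in\mathbb{N}$. A graph is chordal if it has no induced cycle on at least four vertices. A group is power-chordal if its power graph is chordal. *)

(* Defs.v *)
From HB Require Import structures.
From mathcomp Require Import all_boot all_order all_algebra all_fingroup.

Set Implicit Arguments.
Unset Strict Implicit.
Unset Printing Implicit Defensive.

Import GroupScope.

Record sgraph := SGraph {
  vertex :> Type;
  adj : vertex -> vertex -> Prop;
  adj_sym : forall x y, adj x y -> adj y x;
  adj_irrefl : forall x, ~ adj x x
}.

(* ordS is the successor modulo n. *)
Definition induced_cycle (Gr : sgraph) (n : nat) (c : 'I_n -> Gr) : Prop :=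
  injective c /\
  forall i j : 'I_n, adj (c i) (c j) <-> (j = ordS i \/ i = ordS j).

Definition chordal (Gr : sgraph) : Prop :=
  ~ exists (n : nat) (c : 'I_n -> Gr), (4 <= n)%N /\ induced_cycle c.

Section PowerGraph.
Variable G : groupType.

Definition power_adj (x y : G) : Prop :=
  x <> y /\ exists m : nat, x ^+ m = y \/ y ^+ m = x.

Lemma power_adj_sym (x y : G) : power_adj x y -> power_adj y x.
Proof.
move=> [neq_xy [m xy]]; split; first by move=> eq_yx; apply: neq_xy.
by exists m; case: xy; [right | left].
Qed.

Lemma power_adj_irrefl (x : G) : ~ power_adj x x.
Proof. by case. Qed.

Definition power_graph : sgraph := SGraph power_adj_sym power_adj_irrefl.

Definition power_chordal : Prop := chordal power_graph.

End PowerGraph.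

Section SpecialLinear.
Variables (n : nat) (F : finFieldType).

(* As for {'GL_n[F]}, the matrices have size n.-1.+1, which is n for n > 0. *)
Definition SLgroup : {set {'GL_n[F]}} := [set u | (\det (GLval u) == 1)%R].

Lemma SLgroup_group_set : group_set SLgroup.
Proof.
apply/group_setP; split=> [|u v]; first by rewrite inE GL_1E det1.
by rewrite !inE GL_ME det_mulmx => /eqP-> /eqP->; rewrite GRing.mulr1.
Qed.

Canonical SLgroup_group := Group SLgroup_group_set.

End SpecialLinear.

Notation "''SL_' n [ F ]" := (SLgroup_group n F)
  (at level 8, n at level 2, format "''SL_' n [ F ]") : Group_scope.

(* Main.v *)
Require Import Defs.
From mathcomp Require Import all_boot all_order all_algebra all_fingroup.
From mathcomp Require Import cyclic pgroup finfield mxpoly ring zify.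

Set Implicit Arguments.
Unset Strict Implicit.
Unset Printing Implicit Defensive.

Import GroupScope.

(** Two elements are adjacent in the power graph when one of them generates a
subgroup containing the other, so the graph is governed by inclusion of cyclic
subgroups, and the orders of elements decide both halves.

If every element has prime power order, the subgroups of any given cyclic
subgroup form a chain. Hence, along an induced path u - v - w, neither
u, w <= v nor u <= v <= w is possible: v must lie in both <[u]> and <[w]>. On an
induced cycle every vertex is such a middle vertex, so two consecutive vertices
generate the same subgroup, and this makes the vertices around them adjacent
(pelt_power_chordal). In SL_3 over the field with two elements, the
characteristic polynomial is one of the four polynomials X^3 + b X^2 + a X + 1,
each of which divides X^3 + 1, X^4 + 1 or X^7 + 1; by the Cayley-Hamilton
theorem every element has order dividing 3, 4 or 7 (SL3_F2_expg).

Conversely, suppose that two elements x and y that do not commute have a common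
power s whose order is not a prime power, and split s into commuting factors z
and t of coprime orders, both nontrivial. Then x - z - y - t - x is an induced
4-cycle (noncomm_not_power_chordal). In SL_3 over the field with four elements
the centre consists of the scalars 1, w, w^2, and two noncommuting unipotent
elements of order 4 can have the same square, a transvection; multiplying both
by w gives x and y with x^2 = y^2 of order 6 (SL3_F4_noncomm_roots). *)

(** * Power graphs of finite groups *)

Lemma power_adjE (gT : finGroupType) (x y : gT) :
  power_adj x y <-> x <> y /\ (y \in <[x]> \/ x \in <[y]>).
Proof.
split=> -[neq_xy].
  by case=> m [def | def]; split=> //; [left | right]; rewrite -def mem_cycle.
by case=> /cycleP[m def]; split=> //; exists m; auto.
Qed.

Lemma mem_cycle_trans (gT : finGroupType) (x y z : gT) :
  x \in <[y]> -> y \in <[z]> -> x \in <[z]>.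
Proof. by move=> xy; rewrite -cycle_subG => /subsetP; apply. Qed.

(** In a cyclic group inclusion of subgroups is divisibility of their orders,
and the divisors of a prime power form a chain. *)
Lemma cycle_pelt_total (gT : finGroupType) (p : nat) (w x y : gT) :
  p.-elt w -> x \in <[w]> -> y \in <[w]> -> y \in <[x]> \/ x \in <[y]>.
Proof.
move=> pw wx wy.
have mem_dvd u v : u \in <[w]> -> v \in <[w]> -> #[u] %| #[v] -> u \in <[v]>.
  move=> wu wv uv; rewrite -cycle_subG.
  by rewrite -(cardSg_cyclic (cycle_cyclic w)) // cycle_subG.
have pX u : u \in <[w]> -> #[u] = (p ^ logn p #[u])%N.
  by move=> wu; rewrite -p_part part_pnat_id //; apply: mem_p_elt pw wu.
have [le_xy | /ltnW le_yx] := leqP (logn p #[x]) (logn p #[y]); [right | left];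
  by apply: mem_dvd => //; rewrite (pX x) // (pX y) // dvdn_exp2l.
Qed.

Lemma iter_ordS_neq (n k : nat) (i : 'I_n) : 0 < k < n -> iter k (@ordS n) i <> i.
Proof.
move=> k_n /(congr1 val).
have -> : val (iter k (@ordS n) i) = (i + k) %% n.
  elim: k {k_n} => [|k IHk]; first by rewrite addn0 modn_small.
  by rewrite iterS /= IHk -addn1 modnDml addn1 addnS.
have := ltn_ord i; have [lt_ikn | le_nik] := ltnP (i + k) n => ?.
  by rewrite modn_small //=; lia.
have -> : (i + k = i + k - n + n)%N by lia.
by rewrite modnDr modn_small /=; lia.
Qed.

(** Incomparable vertices at distance two on an induced cycle force their common
neighbour below both of them, which cannot happen at two consecutive vertices. *)
Lemma pelt_power_chordal (gT : finGroupType) :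
  (forall x : gT, exists p : nat, p.-elt x) -> power_chordal gT.
Proof.
move=> allp [n [c [n_ge4 [inj_c adj_c]]]].
(* As n >= 4, the indices i and i + 2 differ and are not neighbours. *)
have incomp i :
  ~ (c (ordS (ordS i)) \in <[c i]> \/ c i \in <[c (ordS (ordS i))]>).
  move=> cmp; have : power_adj (c i) (c (ordS (ordS i))).
    apply/power_adjE; split=> // /inj_c/esym; by apply: (@iter_ordS_neq n 2); lia.
  by case/adj_c => [/(@iter_ordS_neq n 1 (ordS i)) | /esym/(@iter_ordS_neq n 3)];
    apply; lia.
have mid i : c (ordS i) \in <[c i]> /\ c (ordS i) \in <[c (ordS (ordS i))]>.
  have [p pci] := allp (c (ordS i)).
  have /power_adjE[_ c01] : power_adj (c i) (c (ordS i)) by apply/adj_c; left.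
  have /power_adjE[_ c12] : power_adj (c (ordS i)) (c (ordS (ordS i))).
    by apply/adj_c; left.
  have := incomp i; case: c01 c12 => [c10 | c01] [c21 | c12] // [].
  - by left; apply: mem_cycle_trans c21 c10.
  - exact: cycle_pelt_total pci c01 c21.
  - by right; apply: mem_cycle_trans c01 c12.
have i : 'I_n by exists 0; lia.
have [_ c12] := mid i; have [_ c23] := mid (ordS i).
by apply: (incomp (ordS i)); right; apply: mem_cycle_trans c12 c23.
Qed.

Lemma four_cycle_not_chordal (Gr : sgraph) (a b c d : Gr) :
    adj a b -> adj b c -> adj c d -> adj d a ->
    ~ adj a c -> ~ adj b d -> a <> c -> b <> d ->
  ~ chordal Gr.
Proof.
move=> ab bc cd da nac nbd neq_ac neq_bd; apply.
have neq_adj (u v : Gr) : adj u v -> u <> v.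
  by move=> + eq_uv; rewrite eq_uv => /adj_irrefl.
have nca : ~ adj c a by move/adj_sym.
have ndb : ~ adj d b by move/adj_sym.
exists 4, (fun i : 'I_4 => nth a [:: a; b; c; d] i); split=> //.
split=> -[[|[|[|[|//]]]] i_lt] [[|[|[|[|//]]]] j_lt] /=.
all: try by [].
(* What remains is injectivity, settled by the next step, and the sixteen entries
   of the adjacency table. *)
all: try by [move=> _; apply: val_inj | move/neq_adj
            | move/esym/neq_adj | move/esym].
all: split=> [|[] /(congr1 val)] //.
all: try by [move/adj_irrefl | move=> _; apply: adj_sym].
all: by move=> _; (left + right); apply: val_inj.
Qed.

(** The induced 4-cycle consists of x, the pi-part of s := x ^+ m, y and the
pi'-part of s. Its two diagonals are missing for different reasons: elements of
which one is a power of the other commute, unlike x and y, and nontrivial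
elements of coprime orders are never powers of one another. *)
Lemma noncomm_not_power_chordal (gT : finGroupType) (pi : nat_pred)
    (m n : nat) (x y : gT) :
    x ^+ m = y ^+ n -> ~ commute x y ->
    ~~ pi.-elt (x ^+ m) -> ~~ pi^'.-elt (x ^+ m) ->
  ~ power_chordal gT.
Proof.
move=> eq_xy ncxy; set s := x ^+ m => np np'.
have xs : s \in <[x]> by apply: mem_cycle.
have ys : s \in <[y]> by rewrite /s eq_xy mem_cycle.
have rho_s rho : s.`_rho \in <[s]> by apply: mem_cycle.
have comm_xy : ~ (x \in <[y]> \/ y \in <[x]>).
  case=> /cycleP[k def]; apply: ncxy; rewrite def; last exact: commuteX.
  by apply/commute_sym; apply: commuteX.
have neq_xy : x <> y by move=> def; apply: ncxy; rewrite def.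
have adj_s rho : power_adj x s.`_rho /\ power_adj y s.`_rho.
  have xz : s.`_rho \in <[x]> by apply: mem_cycle_trans (rho_s rho) xs.
  have yz : s.`_rho \in <[y]> by apply: mem_cycle_trans (rho_s rho) ys.
  split; apply/power_adjE; split; try by left.
    by move=> def; apply: comm_xy; left; rewrite def.
  by move=> def; apply: comm_xy; right; rewrite def.
have pp'_s : ~ (s.`_pi^' \in <[s.`_pi]> \/ s.`_pi \in <[s.`_pi^']>).
  have constt0 rho : s.`_rho \in <[s.`_rho^']> -> rho^'.-elt s.
    move/(mem_p_elt (p_elt_constt _ _))/constt1P.
    by rewrite constt_p_elt ?p_elt_constt // => /constt1P.
  case=> [s_p' | /constt0 /(negP np')] //; case/negP: np.
  by rewrite /p_elt -pnatNK; apply: constt0; rewrite (eq_constt s (negnK _)).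
apply: (@four_cycle_not_chordal (power_graph gT) x s.`_pi y s.`_pi^') => //=.
- exact: (adj_s _).1.
- exact/power_adj_sym/(adj_s _).2.
- exact: (adj_s _).2.
- exact/power_adj_sym/(adj_s _).1.
- by case/power_adjE=> _ [] ?; apply: comm_xy; auto.
- by case/power_adjE=> _ /pp'_s.
- by move=> def; apply: pp'_s; left; rewrite -def cycle_id.
Qed.

Lemma noncomm_not_power_chordal_subg (gT : finGroupType) (G : {group gT})
    (pi : nat_pred) (m n : nat) (x y : gT) :
    x \in G -> y \in G -> x ^+ m = y ^+ n -> ~ commute x y ->
    ~~ pi.-elt (x ^+ m) -> ~~ pi^'.-elt (x ^+ m) ->
  ~ power_chordal (subg_of G).
Proof.
move=> Gx Gy eq_xy ncxy np np'.
have valX z k : z \in G -> sgval (subg G z ^+ k) = z ^+ k.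
  by move=> Gz; rewrite morphX ?inE //; congr (_ ^+ k); apply: subgK.
have pX rho : rho.-elt (subg G x ^+ m) = rho.-elt (x ^+ m).
  rewrite /p_elt -[in RHS](valX x m Gx).
  by rewrite [in RHS](order_injm (injm_sgval G) (in_setT _)).
apply: (@noncomm_not_power_chordal _ pi m n (subg G x) (subg G y)); rewrite ?pX //.
  by apply: subg_inj; rewrite !valX.
by move/(congr1 sgval); rewrite !sgvalM ?inE // !subgK.
Qed.

(** * Elements of SL_3 over the fields with two and four elements *)

Section SpecialLinear3.
Local Open Scope ring_scope.
Import GRing.Theory.

Lemma addrr_card (F : finFieldType) k : #|F| = (2 ^ k)%N -> 1 + 1 = 0 :> F.
Proof. by move/card_finPcharP=> /(_ isT)/pcharf0. Qed.

(** The tactic ring does not reduce coefficients modulo 2, so identities in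
characteristic 2 are proved with an explicit even correction term. *)
Lemma eq_char2 (R : comNzRingType) (a b q : R) :
  1 + 1 = 0 :> R -> a = b + (1 + 1) * q -> a = b.
Proof. by move=> -> ->; rewrite mul0r addr0. Qed.

Lemma poly_size4 (R : nzRingType) (p : {poly R}) : size p = 4 ->
  p = p`_3 *: 'X^3 + p`_2 *: 'X^2 + p`_1 *: 'X + (p`_0)%:P.
Proof.
move=> sp; apply/polyP=> -[|[|[|[|i]]]].
all: rewrite !coefE /= ?(mulr0, mulr1, addr0, add0r) //.
by rewrite nth_default ?sp.
Qed.

Lemma card2_01 (F : finFieldType) (a : F) : #|F| = 2 -> a = 0 \/ a = 1.
Proof.
move=> cF; have [->|a0] := eqVneq a 0; [by left | right].
by apply: (mulfI a0); have := expf_card a; rewrite cF expr2 => ->; rewrite mulr1.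
Qed.

(** Among the four cubics, X^3 + 1 is itself of the required form,
X^3 + X^2 + X + 1 is (X + 1)^3, a divisor of (X + 1)^4 = X^4 + 1, and the two
irreducible ones are the cubic factors of X^7 + 1. *)
Lemma monic_cubic_F2 (F : finFieldType) (p : {poly F}) : #|F| = 2 ->
    p \is monic -> size p = 4 -> p`_0 = 1 ->
  exists n q, n \in [:: 3; 4; 7] /\ 'X^n + 1 = p * q.
Proof.
move=> cF mp sp p0.
have two0 : 1 + 1 = 0 :> {poly F} by rewrite -!polyC1 -polyCD (addrr_card (k := 1)).
have p3 : p`_3 = 1 by move/monicP: mp; rewrite lead_coefE sp.
rewrite (poly_size4 sp) p0 p3.
case: (card2_01 p`_2 cF) (card2_01 p`_1 cF) => -> [] ->.
all: rewrite ?scale0r ?scale1r ?addr0 polyC1; move: ('X : {poly F}) => X.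
(* Over the integers the two irreducible cubics and X + 1 multiply to
   X^7 + 1 + 2 r. *)
all: pose r := X ^+ 6 + X ^+ 5 + 2 * X ^+ 4 + 2 * X ^+ 3 + X ^+ 2 + X.
- by exists 3, 1; rewrite mulr1.
- exists 7, ((X ^+ 3 + X ^+ 2 + 1) * (X + 1)); split=> //.
  by apply/esym/(eq_char2 (q := r) two0); rewrite /r; ring.
- exists 7, ((X ^+ 3 + X + 1) * (X + 1)); split=> //.
  by apply/esym/(eq_char2 (q := r) two0); rewrite /r; ring.
- exists 4, (X + 1); split=> //.
  by apply/esym/(eq_char2 (q := X ^+ 3 + X ^+ 2 + X) two0); ring.
Qed.

(** By Cayley-Hamilton it suffices that the characteristic polynomial, whose
constant term is the determinant up to sign, divides 'X^n + 1. *)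
Lemma SL3_F2_expg (F : finFieldType) (u : {'GL_3[F]}) : #|F| = 2 ->
  u \in 'SL_3[F]%G -> exists2 n, n \in [:: 3; 4; 7] & (u ^+ n = 1)%g.
Proof.
move=> cF; rewrite inE => /eqP det_u.
set A : 'M_3 := GLval u.
have one_opp : -1 = 1 :> F.
  by apply/eqP; rewrite eq_sym -addr_eq0 (addrr_card (k := 1)).
have oneM_opp : -1 = 1 :> 'M[F]_3.
  by rewrite -(scaleN1r 1) one_opp scale1r.
have [|||n [q [n_in def]]] := @monic_cubic_F2 F (char_poly A) cF.
- exact: char_poly_monic.
- by rewrite size_char_poly.
- by rewrite char_poly_det det_u one_opp expr1n mulr1.
exists n => //; apply: val_inj; rewrite FinRing.val_unitX /=.
have /(congr1 (horner_mx A)) := def; rewrite rmorphM /= Cayley_Hamilton mul0r.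
rewrite rmorphD rmorphXn rmorph1 /= horner_mx_X => /eqP.
by rewrite addr_eq0 oneM_opp => /eqP.
Qed.

(** Lower triangular rather than upper triangular, to match is_trig_mx. *)
Definition ltri3 (F : nzRingType) (d a b c : F) : 'M[F]_3 :=
  \matrix_(i, j) nth 0 (nth [::] [:: [:: d]; [:: a; d]; [:: c; b; d]] i) j.

Lemma ltri3M (F : comNzRingType) (d a b c d' a' b' c' : F) :
  ltri3 d a b c * ltri3 d' a' b' c' =
  ltri3 (d * d') (a * d' + d * a') (b * d' + d * b') (c * d' + b * a' + d * c').
Proof.
apply/matrixP=> -[[|[|[|//]]] i_lt] [[|[|[|//]]] j_lt].
all: by rewrite !mxE !big_ord_recl big_ord0 !mxE /=; ring.
Qed.

Lemma ltri3_inj (F : nzRingType) (d a b c d' a' b' c' : F) :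
  ltri3 d a b c = ltri3 d' a' b' c' -> [/\ d = d', a = a', b = b' & c = c'].
Proof.
move/matrixP=> eqA.
have := eqA ord0 ord0; have := eqA 1 0; have := eqA 2%:R 1.
by have := eqA 2%:R 0; rewrite !mxE /= => -> -> -> ->.
Qed.

Lemma ltri3_1 (F : nzRingType) : ltri3 1 0 0 0 = 1 :> 'M[F]_3.
Proof.
by apply/matrixP=> -[[|[|[|//]]] i_lt] [[|[|[|//]]] j_lt]; rewrite !mxE.
Qed.

Lemma ltri3_SL (F : finFieldType) (d a b c : F) : d ^+ 3 = 1 ->
  exists2 u : {'GL_3[F]}, u \in 'SL_3[F]%G & GLval u = ltri3 d a b c.
Proof.
move=> d3; have detA : \det (ltri3 d a b c) = 1.
  rewrite det_trig.
    by rewrite !big_ord_recl big_ord0 !mxE /= mulr1 -d3 !exprS expr0 mulr1.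
  by apply/is_trig_mxP=> -[[|[|[|//]]] i_lt] [[|[|[|//]]] j_lt]; rewrite !mxE.
have unitA : ltri3 d a b c \is a GRing.unit by rewrite unitmxE detA unitr1.
by exists (FinRing.Unit unitA) => //; rewrite inE /= detA.
Qed.

Lemma card4_omega (F : finFieldType) : #|F| = 4 ->
  exists2 w : F, w ^+ 3 = 1 & w ^+ 2 != 1.
Proof.
move=> cF.
have /subsetPn[w _] : ~~ (F \subset [set (0 : F); 1]).
  by apply/negP=> /subset_leq_card; rewrite cF cards2; case: (_ != _).
rewrite !inE negb_or => /andP[w0 w1].
have w3 : w ^+ 3 = 1.
  by apply: (mulfI w0); rewrite mulr1 -exprS; have := expf_card w; rewrite cF.
exists w => //; apply: contra w1 => /eqP w2.
by rewrite -w3 exprS w2 mulr1.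
Qed.

Lemma GL_XE (n : nat) (F : finFieldType) (u : {'GL_n[F]}) k :
  GLval (u ^+ k)%g = GLval u ^+ k.
Proof. exact: FinRing.val_unitX. Qed.

(** With w a primitive cube root of unity, the witnesses are ltri3 w 1 w 0 and
ltri3 w w 1 0. A product of such matrices has a corner entry b * a', which
depends on the order of the factors, whereas in a square the off-diagonal
entries a and b double, hence vanish, and the corner b * a is w for both. The
common square s is the scalar w^2 times a transvection: its cube is a
transvection, its own square is the scalar w, so its order is exactly 6. *)
Lemma SL3_F4_noncomm_roots (F : finFieldType) : #|F| = 4 ->
  exists x y : {'GL_3[F]}, [/\ x \in 'SL_3[F]%G, y \in 'SL_3[F]%G,
    (x ^+ 2 = y ^+ 2)%g, ~ commute x y & #[x ^+ 2]%g = 6].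
Proof.
move=> cF; have [w w3 w2] := card4_omega cF.
have two0 : 1 + 1 = 0 :> F by apply: (addrr_card (k := 2)).
have [x SLx valx] := ltri3_SL 1 w 0 w3.
have [y SLy valy] := ltri3_SL w 1 0 w3.
have valx2 : GLval (x ^+ 2)%g = ltri3 (w ^+ 2) 0 0 w.
  rewrite GL_XE valx expr2 ltri3M; congr ltri3; try ring.
    by apply: (eq_char2 (q := w) two0); ring.
  by apply: (eq_char2 (q := w ^+ 2) two0); ring.
have valy2 : GLval (y ^+ 2)%g = ltri3 (w ^+ 2) 0 0 w.
  rewrite GL_XE valy expr2 ltri3M; congr ltri3; try ring.
    by apply: (eq_char2 (q := w ^+ 2) two0); ring.
  by apply: (eq_char2 (q := w) two0); ring.
exists x, y; split=> //.
- by apply: val_inj; apply: etrans valx2 (esym valy2).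
- move/(congr1 (@GLval 3 F)); rewrite !GL_ME valx valy !ltri3M.
  case/ltri3_inj=> _ _ _; rewrite !(mulr0, mul0r, add0r, addr0) mulr1 => ww.
  by case/eqP: w2; rewrite expr2.
set s := (x ^+ 2)%g in valx2 *.
have vals2 : GLval (s ^+ 2)%g = ltri3 w 0 0 0.
  rewrite GL_XE valx2 expr2 ltri3M; congr ltri3; try ring: w3.
  by apply: (eq_char2 (q := 1) two0); ring: w3.
have vals3 : GLval (s ^+ 3)%g = ltri3 1 0 0 (w ^+ 2).
  by rewrite expgS GL_ME valx2 vals2 ltri3M; congr ltri3; ring: w3.
have vals6 : GLval (s ^+ 6)%g = 1.
  rewrite (expgM s 3 2) GL_XE vals3 expr2 ltri3M -ltri3_1.
  congr ltri3; try ring; by apply: (eq_char2 (q := w ^+ 2) two0); ring.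
have s6 : (#[s]%g %| 6)%N by rewrite order_dvdn; apply/eqP/val_inj.
have s2 : ~~ (#[s]%g %| 2)%N.
  rewrite order_dvdn; apply: contra w2 => /eqP/(congr1 (@GLval 3 F)).
  by rewrite GL_1E vals2 -ltri3_1 => /ltri3_inj[-> _ _ _]; rewrite expr1n.
have s3 : ~~ (#[s]%g %| 3)%N.
  rewrite order_dvdn; apply/eqP => /(congr1 (@GLval 3 F)).
  rewrite GL_1E vals3 -ltri3_1 => /ltri3_inj[_ _ _ w20].
  by have := oner_neq0 F; rewrite -w3 exprS w20 mulr0 eqxx.
have := s6; rewrite dvdn_divisors // !inE.
by case/or4P=> /eqP o_s; move: s2 s3; rewrite o_s.
Qed.

End SpecialLinear3.

Theorem lemma3p22 (F2 F4 : finFieldType) (hF2 : #|F2| = 2) (hF4 : #|F4| = 4) :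
  power_chordal (subg_of 'SL_3[F2]%G) /\ ~ power_chordal (subg_of 'SL_3[F4]%G).
Proof.
split.
  apply: pelt_power_chordal => x.
  have [n n_in xn1] := SL3_F2_expg hF2 (subgP x).
  have ox : #[x] %| n.
    by rewrite -(order_injm (injm_sgval _)) ?inE // order_dvdn xn1.
  move: n_in ox; rewrite !inE => /or3P[] /eqP -> ox;
    [exists 3 | exists 2 | exists 7]; exact: pnat_dvd ox _.
have [x [y [SLx SLy eq_xy ncxy o_s]]] := SL3_F4_noncomm_roots hF4.
apply: (noncomm_not_power_chordal_subg (pi := 2) SLx SLy eq_xy ncxy).
all: by rewrite /p_elt o_s.
Qed.
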